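(* Let $W$ be a Coxeter group of rank three and let $w\in W$. If $J,K\in\mathsf{BP}(w)$, then $J\cap K\in\mathsf{BP}(w)$ and $J\cup K\in\mathsf{BP}(w)$.
   Context: $W$ is an arbitrary (possibly infinite) Coxeter group with simple reflections $S$, $|S|=3$. For $J\subset S$, $W_J$ is the parabolic subgroup generated by $J$, and $W^J$ is the set of minimal-length representatives of the cosets $W/W_J$. Each $w\in W$ factors uniquely as $w=w^Jw_J$ with $w^J\in W^J$, $w_J\in W_J$. Write $\operatorname{Supp}(w)=\{s\in S\mid s\le w \text{ in Bruhat order}\}$ and $D_L(w)=\{s\in S\mid \ell(sw)<\ell(w)\}$. The decomposition $w=w^Jw_J$ is a Billey--Postnikov (BP) decomposition if $\operatorname{Supp}(w^J)\cap J\subset D_L(w_J)$; $\mathsf{BP}(w)$ is the set of $J\subset S$ for which this holds. *)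

(* Defs.v *)
From HB Require Import structures.
From Stdlib Require Import Relation_Operators.
From mathcomp Require Import all_boot.
From mathcomp Require Import boolp.

Set Implicit Arguments.
Unset Strict Implicit.
Unset Printing Implicit Defensive.

Local Open Scope group_scope.

(* The value 0 stands for m(s,t) = infinity, i.e. no relation between s and t. *)
Definition coxeter_matrix (S : finType) (m : S -> S -> nat) : Prop :=
  [/\ forall s, m s s = 1%N,
      forall s t, m s t = m t s
    & forall s t, s != t -> m s t != 1%N].

(* The word (s t)^k. *)
Definition braid_word (S : Type) (s t : S) (k : nat) : seq S :=
  flatten (nseq k [:: s; t]).

(* The congruence on words generated by (s t)^m(s,t) ~ 1.  As m(s,s) = 1 gives
   s s ~ 1, every letter is its own inverse modulo this congruence, so that the
   quotient of the free monoid on S is the group presented by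
   < S | (s t)^m(s,t) = 1 >; no formal inverses are needed.  For m(s,t) = 0 the
   relation is trivial. *)
Inductive coxeter_congr (S : finType) (m : S -> S -> nat) :
    seq S -> seq S -> Prop :=
| CoxeterRel a b s t :
    coxeter_congr m (a ++ braid_word s t (m s t) ++ b) (a ++ b)
| CoxeterRefl a : coxeter_congr m a a
| CoxeterSym a b : coxeter_congr m a b -> coxeter_congr m b a
| CoxeterTrans a b c :
    coxeter_congr m a b -> coxeter_congr m b c -> coxeter_congr m a c.

Definition word_prod (W : groupType) (S : Type) (gen : S -> W) (a : seq S) : W :=
  \big[*%g/1]_(s <- a) gen s.

(* A Coxeter system (W, S): the group W is presented by the generators gen s,
   s in S, and the relations (s t)^m(s,t) = 1. *)
Record coxeterSystem := CoxeterSystem {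
  cox_group :> groupType;
  simple_refl : finType;
  cox_mat : simple_refl -> simple_refl -> nat;
  gen : simple_refl -> cox_group;
  cox_matP : coxeter_matrix cox_mat;
  genP : forall w : cox_group, exists a : seq simple_refl, word_prod gen a = w;
  presP : forall a b : seq simple_refl,
    word_prod gen a = word_prod gen b <-> coxeter_congr cox_mat a b
}.
Arguments gen {c}.

Section CoxeterCombinatorics.
Variable W : coxeterSystem.
Local Notation S := (simple_refl W).
Implicit Types (u v w : W) (J : {set S}).

Lemma has_word w :
  exists n, [exists a : n.-tuple S, word_prod gen a == w].
Proof.
have [a <-] := genP w.
by exists (size a); apply/existsP; exists (in_tuple a).
Qed.

Definition len w : nat := ex_minn (has_word w).

Definition reflection (t : W) : Prop := exists (s : S) (x : W), t = gen s ^ x.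

Definition bruhat_step u v : Prop :=
  exists2 t, reflection t & v = u * t /\ len u < len v.

Definition bruhat_le : W -> W -> Prop := clos_refl_trans W bruhat_step.

Definition Supp w : {set S} := [set s | `[< bruhat_le (gen s) w >]].

Definition DL w : {set S} := [set s | len (gen s * w) < len w].

(* The subgroup W_J generated by J. *)
Inductive parabolic J : W -> Prop :=
| ParabolicGen s : s \in J -> parabolic J (gen s)
| Parabolic1 : parabolic J 1
| ParabolicM x y : parabolic J x -> parabolic J y -> parabolic J (x * y)
| ParabolicV x : parabolic J x -> parabolic J x^-1.

(* W^J: v has minimal length in its coset v W_J. *)
Definition min_coset_rep J v : Prop :=
  forall x, parabolic J x -> len v <= len (v * x).

(* v = w^J and u = w_J; such a pair exists and is unique. *)
Definition parabolic_decomp J w v u : Prop :=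
  [/\ min_coset_rep J v, parabolic J u & w = v * u].

Definition BP w J : Prop :=
  exists v u, parabolic_decomp J w v u /\ Supp v :&: J \subset DL u.

End CoxeterCombinatorics.

(* Main.v *)
(* For the union, {s} is in BP(w) iff s is a right descent of w or s is not in
   Supp(w).  If s and t are both right descents of w, then w_{s,t} is the
   longest element of W_{s,t}; a letter outside Supp(w) can be added to any
   member of BP(w).

   For the intersection, let J = {s,t} and K = {r,t} be in BP(w) and suppose
   that t is in Supp(w) but is not a right descent of w.  Write w = v u with
   v = w^J and u = w_J.  Then w has reduced words ending in ts and in tr, so s
   and r are right descents of w, W_{s,r} is finite, and wr has both s and t as
   right descents.  By exchange wr = v'u with v' a subword of v.  Write
   v' = v1 x with v1 in W^J and x in W_L, L = Supp(v) :&: J.  As L consists of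
   left descents of u, len (x u) <= len u; as all of J descends wr = v1 (x u),
   x u is the longest element of W_J, hence len (u t) <= len (x u) <= len u,
   contradicting len u < len (u t).

   The exchange condition comes from the parity of the number of times a
   reflection occurs among the inversions of a word, which depends only on the
   product of the word; injectivity of the generators comes from the geometric
   representation. *)

Require Import Defs.
From mathcomp Require Import all_boot.
From Stdlib Require Import Relation_Operators.
From mathcomp Require Import boolp all_algebra all_field ring.

Set Implicit Arguments.
Unset Strict Implicit.
Unset Printing Implicit Defensive.

(** * The geometric representation and distinctness of the simple reflections *)

Section GeometricAction.
Import GRing.Theory Num.Theory.
Local Open Scope ring_scope.
Variables (S : finType) (m : S -> S -> nat).
Hypothesis mP : coxeter_matrix m.

(* With a primitive [2 m]-th root of unity, [cartan] below is a Galois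
   conjugate of [2 cos (pi / m)]; the junk value at [m = 0] is harmless. *)
Definition double_root (k : nat) : algC :=
  if k is k'.+1 then sval (C_prim_root_exists (isT : 0 < (k'.+1).*2)%N) else 1.

Definition cartan (s t : S) : algC :=
  if s == t then 2%:R else double_root (m s t) + (double_root (m s t))^-1.

(* The contragredient of the geometric representation, in the coordinates
   given by evaluation at the simple roots. *)
Definition simple_act (f : S -> algC) (s : S) : S -> algC :=
  fun u => f u - f s * cartan s u.

Definition word_act : (S -> algC) -> seq S -> S -> algC := foldl simple_act.

Lemma double_rootP k : (0 < k)%N -> k.*2.-primitive_root (double_root k).
Proof.
by case: k => // k _; rewrite /double_root; case: C_prim_root_exists.
Qed.

Lemma double_root_neq0 k : (0 < k)%N -> double_root k != 0.
Proof.
move=> k0; apply/eqP => e; have := prim_expr_order (double_rootP k0).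
by rewrite e expr0n -(prednK k0) /= => /esym/eqP; rewrite oner_eq0.
Qed.

(** Acting by [s] or [t] only ever subtracts multiples of [cartan s] and [cartan t]. Triviality of a
    braid relation thus reduces to the vanishing of two scalars, decided by the values at [s] and
    [t]. *)
Lemma word_act_braid_span f s t k : exists X Y, forall u,
  word_act f (braid_word s t k) u = f u - X * cartan s u - Y * cartan t u.
Proof.
elim: k f => [|k IH] f; first by exists 0, 0 => u; rewrite /= !mul0r !subr0.
have [X [Y E]] := IH (simple_act (simple_act f s) t).
exists (X + f s), (Y + simple_act f s t) => u.
rewrite [LHS]E {1}/simple_act {1}/simple_act; ring.
Qed.

(** The forms [f t - eta * f s] and [f t - eta^-1 * f s] diagonalize the action of [s] followed by
    [t] on the values at [s] and [t], with eigenvalues [eta ^+ 2] and its inverse. *)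
Lemma word_act_braid_eigen f s t k : s != t -> (0 < m s t)%N ->
  let eta := double_root (m s t) in
  let g := word_act f (braid_word s t k) in
    g t - eta * g s = (eta ^+ 2) ^+ k * (f t - eta * f s)
 /\ g t - eta^-1 * g s = (eta^-1 ^+ 2) ^+ k * (f t - eta^-1 * f s).
Proof.
move=> st m0 eta; have eta0 : eta != 0 by apply: double_root_neq0.
elim: k f => [|k IH] f /=; first by rewrite !expr0 !mul1r.
have [E1 E2] := IH (simple_act (simple_act f s) t); rewrite {}E1 {}E2.
have [_ msym _] := mP.
rewrite /simple_act /cartan !eqxx (eq_sym t s) (negbTE st) (msym t s) -/eta.
rewrite !exprSr.
by split; field.
Qed.

Lemma word_act_braid f s t : word_act f (braid_word s t (m s t)) = f.
Proof.
have [m1 msym mN1] := mP.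
have [<-|st] := eqVneq s t.
  apply: funext => u; rewrite m1 /= /simple_act /cartan eqxx; ring.
case m0 : (m s t) => [|k] //; rewrite -m0.
have mpos : (0 < m s t)%N by rewrite m0.
have mgt1 : (1 < m s t)%N by rewrite ltn_neqAle eq_sym mN1.
pose eta := double_root (m s t).
have eta0 : eta != 0 by apply: double_root_neq0.
have etaP := double_rootP mpos.
have etam : (eta ^+ 2) ^+ m s t = 1.
  by rewrite -exprM mul2n prim_expr_order.
(* The order of [eta] is twice [m s t], hence greater than 2. *)
have eta4 : eta ^+ 2 - 1 != 0.
  rewrite subr_eq0 -(prim_order_dvd etaP) -mul2n; apply/negP => /dvdn_leq.
  by move/(_ isT); apply/negP; rewrite -ltnNge ltn_Pmulr.
have [X [Y E]] := word_act_braid_span f s t (m s t).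
have [] := word_act_braid_eigen f (m s t) st mpos.
rewrite -/eta exprVn exprVn etam invr1 !mul1r !E.
have cst : cartan s t = eta + eta^-1 by rewrite /cartan (negbTE st).
have cts : cartan t s = eta + eta^-1.
  by rewrite /cartan eq_sym (negbTE st) msym.
have css u : cartan u u = 2%:R by rewrite /cartan eqxx.
rewrite !css cst cts => /eqP; rewrite -subr_eq0 => /eqP E1.
move=> /eqP; rewrite -subr_eq0 => /eqP E2.
(* Invariance of both eigenforms gives two linear equations in [X] and [Y]; their determinant is
   [eta ^+ 2 - 1] up to sign once that same nonzero factor is cancelled from each. *)
have F1 : X + eta * Y = 0.
  apply: (mulfI eta4); rewrite mulr0 -[RHS](mulr0 eta) -[in RHS]E1.
  by field.
have F2 : eta * X + Y = 0.
  apply: (mulfI eta4); rewrite mulr0 -[RHS](mulr0 (- eta ^+ 2)) -[in RHS]E2.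
  by field.
have X0 : X = 0.
  apply: (mulfI eta4); rewrite mulr0.
  transitivity (eta * (eta * X + Y) - (X + eta * Y)); first by ring.
  by rewrite F1 F2 mulr0 subr0.
have Y0 : Y = 0 by rewrite -F2 X0 mulr0 add0r.
by apply: funext => u; rewrite E X0 Y0 !mul0r !subr0.
Qed.

Lemma word_act_congr f a b : coxeter_congr m a b -> word_act f a = word_act f b.
Proof.
rewrite /word_act => ab; elim: ab f => {a b}
  [a b s t f|//|a b _ IH f|a b c _ IHa _ IHb f]; last by rewrite IHa.
- by rewrite !foldl_cat; congr foldl; apply: word_act_braid.
- by rewrite IH.
Qed.

Lemma simple_congr_inj s t : coxeter_congr m [:: s] [:: t] -> s = t.
Proof.
(* The indicator of [s] takes the value -1 at [s] after acting by [s], but keeps the value 1 there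
   after acting by any other letter. *)
move=> /(word_act_congr (fun u => (u == s)%:R)) /(congr1 (@^~ s)).
rewrite /= /simple_act eqxx /cartan eqxx; case: eqVneq => // ts.
rewrite mul0r subr0 mul1r => /eqP.
by rewrite subr_eq addrC -subr_eq subrr eq_sym pnatr_eq0.
Qed.

End GeometricAction.

(** * Words, length and parity *)

Section CoxeterTheory.
Local Open Scope group_scope.
Variable W : coxeterSystem.
Local Notation S := (simple_refl W).
Implicit Types (u v w x y : W) (s t : S) (a b : seq S) (I J K : {set S}).

Lemma word_prod_nil : word_prod gen [::] = 1 :> W.
Proof. by rewrite /word_prod big_nil. Qed.

Lemma word_prod_cons s a : word_prod gen (s :: a) = gen s * word_prod gen a.
Proof. by rewrite /word_prod big_cons. Qed.

Lemma word_prod_cat a b :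
  word_prod gen (a ++ b) = word_prod gen a * word_prod gen b :> W.
Proof. by rewrite /word_prod big_cat. Qed.

Lemma word_prod_rcons a s : word_prod gen (rcons a s) = word_prod gen a * gen s.
Proof. by rewrite -cats1 word_prod_cat word_prod_cons word_prod_nil mulg1. Qed.

Lemma gen_inj : injective (@gen W).
Proof.
move=> s t st; apply: (simple_congr_inj (@cox_matP W)).
by apply/presP; rewrite !word_prod_cons st.
Qed.

Lemma genK s : gen s * gen s = 1.
Proof.
have [m1 _ _] := @cox_matP W; have := CoxeterRel (@cox_mat W) [::] [::] s s.
by move/presP; rewrite m1 !word_prod_cons word_prod_nil mulg1.
Qed.

Lemma genV s : (gen s)^-1 = gen s.
Proof. by apply/mulg1_eq/genK. Qed.

Lemma mulgenK s x : x * gen s * gen s = x.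
Proof. by rewrite -mulgA genK mulg1. Qed.

Lemma word_prod_rev a : word_prod gen (rev a) = (word_prod gen a)^-1 :> W.
Proof.
elim: a => [|s a IH]; first by rewrite word_prod_nil invg1.
by rewrite rev_cons word_prod_rcons word_prod_cons invgM IH genV.
Qed.

Lemma len_word w : exists2 a, word_prod gen a = w & size a = len w.
Proof.
rewrite /len; case: ex_minnP => n /existsP[a /eqP aw] _.
by exists a => //; rewrite size_tuple.
Qed.

Lemma len_le a : len (word_prod gen a : W) <= size a.
Proof.
rewrite /len; case: ex_minnP => n _; apply; apply/existsP.
by exists (in_tuple a).
Qed.

Lemma len1 : len (1 : W) = 0.
Proof. by apply/eqP; rewrite -leqn0 -word_prod_nil len_le. Qed.

Lemma lenM x y : len (x * y) <= len x + len y.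
Proof.
have [a <- <-] := len_word x; have [b <- <-] := len_word y.
by rewrite -word_prod_cat -size_cat len_le.
Qed.

Lemma lenV x : len x^-1 = len x.
Proof.
suff le y : len y^-1 <= len y by apply/eqP; rewrite eqn_leq le -{1}(invgK x) le.
by have [a <- <-] := len_word y; rewrite -word_prod_rev -(size_rev a) len_le.
Qed.

Lemma len_eq0 x : len x = 0 -> x = 1.
Proof.
by have [[|s a] <- <-] := len_word x; rewrite // word_prod_nil.
Qed.

(** All relators have even length. This excludes [len (w * gen s) = len w] below. *)
Lemma odd_word a b : word_prod gen a = word_prod gen b :> W ->
  odd (size a) = odd (size b).
Proof.
move/presP; elim=> {a b} [a b s t|//|a b _ ->|a b c _ -> _ ->] //.
rewrite !size_cat !oddD; congr (_ (+) _).
suff -> : odd (size (braid_word s t (cox_mat s t))) = false by [].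
by elim: (cox_mat s t) => //= k ->.
Qed.

Lemma odd_len_gen w s : odd (len (w * gen s)) = ~~ odd (len w).
Proof.
have [a aw <-] := len_word (w * gen s); have [b bw <-] := len_word w.
by rewrite (@odd_word a (rcons b s)) ?size_rcons // word_prod_rcons bw.
Qed.

Lemma len_gen s : len (gen s : W) = 1%N.
Proof.
have := len_le [:: s]; have := odd_len_gen 1 s.
rewrite word_prod_cons word_prod_nil mulg1 mul1g len1.
by case: (len _) => [|[]].
Qed.

Lemma len_gen_ltP w s :
  reflect (len w = (len (w * gen s)).+1) (len (w * gen s) < len w).
Proof.
apply: (iffP idP) => [lt|->] //; apply/eqP; rewrite eqn_leq lt andbT.
by rewrite -{1}(mulgenK s w) (leq_trans (lenM _ _)) // len_gen addn1.
Qed.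

Lemma len_gen_ge w s :
  (len w <= len (w * gen s)) = (len w < len (w * gen s)).
Proof.
rewrite leq_eqVlt orb_idl // => /eqP e.
by have := odd_len_gen w s; rewrite -e; case: (odd _).
Qed.

Lemma len_gen_geE w s : len w <= len (w * gen s) ->
  len (w * gen s) = (len w).+1.
Proof.
rewrite len_gen_ge -{1}(mulgenK s w) => /len_gen_ltP ->.
by rewrite mulgenK.
Qed.

(** * Inversions and the strong exchange condition *)

(** Right multiplication of the product of [a] by the i-th entry deletes the i-th letter of [a]. For
    a word that is not reduced, entries may repeat. *)
Fixpoint right_inversions (a : seq S) : seq W :=
  if a is s :: b then gen s ^ word_prod gen b :: right_inversions b else [::].

Lemma right_inversions_cat a b : right_inversions (a ++ b) =
  [seq r ^ word_prod gen b | r <- right_inversions a] ++ right_inversions b.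
Proof. by elim: a => //= s a ->; rewrite word_prod_cat conjgM. Qed.

Lemma count_map_conj (l : seq W) x (t : W) :
  count_mem t [seq r ^ x | r <- l] = count_mem (t ^ x^-1) l.
Proof.
rewrite count_map; apply: eq_count => r /=.
by rewrite (can2_eq (conjgK x) (conjgKV x)).
Qed.

Lemma word_prod_braid s t k :
  word_prod gen (braid_word s t k) = (gen s * gen t) ^+ k :> W.
Proof.
elim: k => [|k IH]; first by rewrite word_prod_nil.
by rewrite /= 2!word_prod_cons IH expgS mulgA.
Qed.

Lemma conj_dihedral s t i k :
  ((gen t * gen s) ^+ i * gen t) ^ ((gen s * gen t) ^+ k) =
  (gen t * gen s) ^+ (k.*2 + i) * gen t :> W.
Proof.
elim: k i => [|k IH] i; first by rewrite conjg1.
rewrite expgS conjgM.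
suff -> : ((gen t * gen s) ^+ i * gen t) ^ (gen s * gen t) =
    (gen t * gen s) ^+ i.+2 * gen t by rewrite IH doubleS !addnS.
by rewrite conjgE invgM !genV expgSr expgS !mulgA.
Qed.

Lemma right_inversions_braid s t k : right_inversions (braid_word s t k) =
  rev [seq (gen t * gen s) ^+ i * gen t | i <- iota 0 k.*2].
Proof.
elim: k => // k IH; rewrite doubleS -addn2 iotaD map_cat rev_cat -{}IH.
rewrite /= add0n word_prod_cons -/(braid_word s t k).
rewrite word_prod_braid; congr [:: _, _ & _].
  rewrite conjgM -[k.*2.+1]addn1 -conj_dihedral; congr (_ ^ _).
  by rewrite conjgE genV mulgA.
by rewrite -[k.*2]addn0 -conj_dihedral mul1g.
Qed.

(* Along [(s t)^m] every reflection is met twice, since [(t s)^i t] is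
   [m]-periodic in [i]. *)
Lemma odd_count_right_inversions a b (t : W) :
  word_prod gen a = word_prod gen b ->
  odd (count_mem t (right_inversions a)) =
  odd (count_mem t (right_inversions b)).
Proof.
move/presP => ab; elim: ab => {a b} [a b r s|//|a b _ ->|a b c _ -> _ ->] //.
set k := cox_mat r s.
have rs1 : (gen r * gen s) ^+ k = 1.
  rewrite -word_prod_braid -(@word_prod_nil); apply/presP.
  by have := CoxeterRel (@cox_mat W) [::] [::] r s; rewrite cats0.
rewrite !right_inversions_cat !count_cat word_prod_cat word_prod_braid rs1 mul1g.
rewrite !oddD; congr (_ (+) _).
rewrite -[RHS]addFb; congr (_ (+) _).
rewrite count_map_conj right_inversions_braid count_rev -addnn iotaD map_cat.
rewrite count_cat oddD; set c := count _ _; set c' := count _ _.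
suff -> : c = c' by rewrite addbb.
rewrite /c /c' (addnC 0 k) iotaDl -map_comp; congr count.
apply: eq_map => i /=; rewrite expgnDr.
suff -> : (gen s * gen r) ^+ k = 1 by rewrite mul1g.
by rewrite -[gen s * gen r]invgK invgM !genV expVgn rs1 invg1.
Qed.

Lemma right_inversions_del a (t : W) : t \in right_inversions a ->
  exists a', [/\ subseq a' a, size a' < size a &
                word_prod gen a' = word_prod gen a * t].
Proof.
elim: a => //= s a IH; rewrite inE => /orP[/eqP ->|/IH[a' [sa lt E]]].
  exists a; split=> //; first exact: (subseq_cons a s).
  by rewrite word_prod_cons -mulgA -conjgC mulgA genK mul1g.
exists (s :: a'); rewrite /= eqxx; split=> //.
by rewrite !word_prod_cons E mulgA.
Qed.

(** Write [t] as a palindrome [rev a ++ s :: a]. The central letter contributes one occurrence of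
    [t]; the two halves together contribute as many as [gen s] has in [a ++ rev a], an even number
    since that word has product 1. *)
Lemma odd_right_inversions_reflection (t : W) : reflection t ->
  exists2 a, word_prod gen a = t & odd (count_mem t (right_inversions a)).
Proof.
case=> s [x ->]; have [a <-] := genP x.
exists (rev a ++ s :: a).
  by rewrite word_prod_cat word_prod_cons word_prod_rev conjgE.
rewrite right_inversions_cat count_cat count_map_conj word_prod_cons /= eqxx.
set x' := word_prod gen a.
have -> : (gen s ^ x') ^ (gen s * x')^-1 = gen s.
  by rewrite -conjgM invgM genV mulgA mulgV mul1g conjgE genV genK mulg1.
have := @odd_count_right_inversions (a ++ rev a) [::] (gen s).
rewrite word_prod_cat word_prod_rev mulgV word_prod_nil => /(_ erefl).
rewrite right_inversions_cat count_cat count_map_conj word_prod_rev invgK /=.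
by rewrite addnCA add1n -/x' /= addnC => ->.
Qed.

Lemma reflectionK (t : W) : reflection t -> t * t = 1.
Proof. by case=> s [x ->]; rewrite -conjMg genK conj1g. Qed.

Lemma odd_right_inversions a (t : W) : reflection t ->
  odd (count_mem t (right_inversions a)) =
  (len (word_prod gen a * t) < len (word_prod gen a)).
Proof.
move=> rt.
have shorter b : odd (count_mem t (right_inversions b)) ->
    len (word_prod gen b * t) < len (word_prod gen b).
  have [c cb <-] := len_word (word_prod gen b).
  rewrite -(odd_count_right_inversions t cb) -cb => oc.
  have /right_inversions_del [c' [_ lt <-]] : t \in right_inversions c.
    by rewrite -has_pred1 has_count; case: (count _ _) oc.
  by rewrite (leq_ltn_trans (len_le _)).
(* For the converse, append an odd word [c] for [t]: an even count in [a] makes the count in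
   [a ++ c] odd, so multiplying by [t] once more shortens the product of [a ++ c]. *)
apply/idP/idP => [/shorter //|lt]; apply: contraTT lt => ev.
have [c ct oc] := odd_right_inversions_reflection rt.
have := shorter (a ++ c); rewrite right_inversions_cat count_cat count_map_conj.
rewrite word_prod_cat ct oddD oc -mulgA (reflectionK rt) mulg1.
rewrite conjgE invgK mulgV mulg1 (negbTE ev) => /(_ isT) lt.
by rewrite -leqNgt ltnW.
Qed.

Lemma strong_exchange a (t : W) : reflection t ->
  len (word_prod gen a * t) < len (word_prod gen a) ->
  t \in right_inversions a.
Proof.
move=> rt; rewrite -odd_right_inversions // -has_pred1 has_count.
by case: (count _ _).
Qed.

Lemma reflection_gen s : reflection (gen s : W).
Proof. by exists s, 1; rewrite conjg1. Qed.

(** * Parabolic subgroups and reduced words *)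

Lemma parabolic_word I a : {subset a <= I} -> parabolic I (word_prod gen a : W).
Proof.
elim: a => [_|s a IH sI]; first by rewrite word_prod_nil; apply: Parabolic1.
rewrite word_prod_cons; apply: ParabolicM.
  by apply/ParabolicGen/sI/mem_head.
by apply: IH => t ta; apply: sI; rewrite inE ta orbT.
Qed.

Lemma parabolicP I w : parabolic I w <->
  exists2 a, word_prod gen a = w & {subset a <= I}.
Proof.
split=> [|[a <-]]; last exact: parabolic_word.
elim=> {w} [s sI| |x y _ [a <- aI] _ [b <- bI]|x _ [a <- aI]].
- exists [:: s] => [|t]; first by rewrite word_prod_cons word_prod_nil mulg1.
  by rewrite inE => /eqP->.
- by exists [::] => //; rewrite word_prod_nil.
- exists (a ++ b); first by rewrite word_prod_cat.
  by move=> s; rewrite mem_cat => /orP[/aI|/bI].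
- exists (rev a) => [|s]; first by rewrite word_prod_rev.
  by rewrite mem_rev => /aI.
Qed.

Lemma parabolicS I J w : I \subset J -> parabolic I w -> parabolic J w.
Proof.
move=> /subsetP IJ /parabolicP[a <- aI]; apply: parabolic_word => s /aI.
exact: IJ.
Qed.

Lemma parabolic_mulr I x y :
  parabolic I x -> parabolic I (x * y) -> parabolic I y.
Proof.
move=> xI xyI; rewrite -(mulKg x y); apply: ParabolicM => //.
exact: ParabolicV.
Qed.

Lemma parabolic_mull I x y :
  parabolic I y -> parabolic I (x * y) -> parabolic I x.
Proof.
move=> yI xyI; rewrite -(mulgK y x); apply: ParabolicM => //.
exact: ParabolicV.
Qed.

Lemma parabolic_strong_exchange I w (t : W) : reflection t -> parabolic I w ->
  len (w * t) < len w -> parabolic I (w * t).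
Proof.
move=> rt /parabolicP[a <- aI] /(strong_exchange rt).
case/right_inversions_del => a' [/mem_subseq sa _ <-].
by apply: parabolic_word => s /sa /aI.
Qed.

(** Build the word letter by letter: a new letter either increases the length or, by exchange, is
    absorbed by passing to a subword, whose letters are still in [I]. *)
Lemma parabolic_reduced I w : parabolic I w ->
  exists a, [/\ word_prod gen a = w, size a = len w & {subset a <= I}].
Proof.
case/parabolicP => a <- {w}; elim/last_ind: a => [|a s IH] aI.
  by exists [::]; rewrite word_prod_nil len1.
have [|b [ba sb bI]] := IH.
  by move=> t ta; rewrite aI // mem_rcons inE ta orbT.
have sI : s \in I by rewrite aI // mem_rcons mem_head.
rewrite word_prod_rcons -ba.
case: (leqP (len (word_prod gen b)) (len (word_prod gen b * gen s))).
  move/len_gen_geE => E; exists (rcons b s).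
  rewrite word_prod_rcons size_rcons sb E ba; split=> // t.
  by rewrite mem_rcons inE => /orP[/eqP->|/bI].
move=> lt; have := strong_exchange (reflection_gen s) lt.
case/right_inversions_del => c [sc ltc cE]; exists c; split=> //.
  apply/eqP; rewrite -cE eqn_leq len_le andbT -ltnS.
  by rewrite cE -(len_gen_ltP _ _ lt) ba -sb.
by move=> t tc; apply: bI; apply: mem_subseq tc.
Qed.

Lemma parabolic_gen I s : parabolic I (gen s : W) -> s \in I.
Proof.
case/parabolic_reduced => -[|t [|r a]] []; rewrite len_gen // => + _.
rewrite word_prod_cons word_prod_nil mulg1 => /gen_inj <-; apply.
exact: mem_head.
Qed.

Lemma parabolic_descent I w s : parabolic I w -> len (w * gen s) < len w ->
  s \in I.
Proof.
move=> wI lt; apply/parabolic_gen/(parabolic_mulr wI).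
exact: parabolic_strong_exchange (reflection_gen s) wI lt.
Qed.

(** The last letter of a reduced word is a right descent, so it lies in [I] and can be stripped
    off. *)
Lemma parabolic_reduced_word I a : parabolic I (word_prod gen a : W) ->
  size a = len (word_prod gen a : W) -> {subset a <= I}.
Proof.
elim/last_ind: a => // a s IH; rewrite word_prod_rcons size_rcons => pI sz.
have lt : len (word_prod gen a * gen s * gen s) < len (word_prod gen a * gen s).
  by rewrite mulgenK -sz ltnS len_le.
have sI := parabolic_descent pI lt.
have aI := parabolic_mull (ParabolicGen sI) pI.
move/len_gen_ltP: lt; rewrite -sz mulgenK => -[sza] t.
by rewrite mem_rcons inE => /orP[/eqP-> // |]; apply: IH.
Qed.

(** The deleted letter lies either in [y] or in [x]. In the second case [x'] is a subword of a
    reduced word of [x], so it stays in every parabolic subgroup containing [x]. *)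
Lemma exchange x y s : len (x * y * gen s) < len (x * y) ->
  len (y * gen s) < len y \/
  exists x', [/\ len x' < len x, x * y * gen s = x' * y &
                forall I, parabolic I x -> parabolic I x'].
Proof.
have [a ax sa] := len_word x; have [b bey sb] := len_word y.
rewrite -ax -bey -word_prod_cat => lt.
have := strong_exchange (reflection_gen s) lt.
rewrite right_inversions_cat mem_cat => /orP[/mapP[r ra rE]|]; last first.
  case/right_inversions_del => b' [_ ltb b'E]; left.
  by rewrite -b'E bey -sb (leq_ltn_trans (len_le _)).
have [a' [suba lta a'E]] := right_inversions_del ra; right.
exists (word_prod gen a'); split.
  by rewrite ax -sa (leq_ltn_trans (len_le _)).
  by rewrite word_prod_cat a'E rE -!mulgA -conjgC.
move=> I; rewrite ax => xI; apply: parabolic_word => t /(mem_subseq suba).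
by apply: parabolic_reduced_word; rewrite ax.
Qed.

(** * Longest elements and minimal coset representatives *)

Lemma parabolic_len_ind I (P : W -> Prop) : P 1 ->
  (forall x s, parabolic I x -> s \in I -> len (x * gen s) = (len x).+1 ->
     P x -> P (x * gen s)) ->
  forall x, parabolic I x -> P x.
Proof.
move=> P1 PS x /parabolic_reduced[a [<- {x}]].
elim/last_ind: a => [|a s IH]; first by rewrite word_prod_nil.
rewrite word_prod_rcons size_rcons => sz aI.
have aI' : {subset a <= I} by move=> t ta; rewrite aI // mem_rcons inE ta orbT.
have sa : size a = len (word_prod gen a : W).
  apply/eqP; rewrite eqn_leq len_le andbT -ltnS sz.
  by rewrite (leq_trans (lenM _ _)) // len_gen addn1.
apply: PS; rewrite ?sz -?sa ?aI ?mem_rcons ?mem_head //.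
  exact: parabolic_word.
exact: IH.
Qed.

(** Induction on [y]: apply exchange to [u = (u * y^-1) * y] and a letter [s] that lengthens [y];
    the deleted letter must come from [u * y^-1]. In particular [len y <= len u] for every [y] in
    [W_I]. *)
Lemma len_mul_longest I u y : (forall s, s \in I -> len (u * gen s) < len u) ->
  parabolic I y -> len (u * y^-1) + len y = len u.
Proof.
move=> uI; elim/parabolic_len_ind => {y} [|y s yI sI ls IH].
  by rewrite invg1 mulg1 len1 addn0.
have := uI s sI; rewrite -{1 2}(mulgVK y u) => /exchange[].
  by rewrite ls ltnNge leqnSn.
case=> x [ltx E _]; rewrite mulgVK in E.
have -> : u * (y * gen s)^-1 = x by rewrite invgM genV mulgA E mulgK.
apply/eqP; rewrite eqn_leq; apply/andP; split.
  by rewrite ls addnS -IH ltn_add2r.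
have := lenM x (y * gen s).
by rewrite mulgA -E mulgenK.
Qed.

(** If a letter [s] of [J] lengthens [x] but shortens [v * x], exchange deletes a letter from [v]
    and yields a shorter element of the coset [v W_J]. *)
Lemma min_coset_repM J v x : min_coset_rep J v -> parabolic J x ->
  len (v * x) = len v + len x.
Proof.
move=> vJ; elim/parabolic_len_ind => {x} [|x s xJ sJ ls IH].
  by rewrite mulg1 len1 addn0.
rewrite mulgA ls addnS -IH; case: leqP (@len_gen_geE (v * x) s) => [_ -> //|].
move=> + _ => /exchange[]; first by rewrite ls ltnNge leqnSn.
case=> v' [ltv E _].
have /vJ : parabolic J (x * gen s * x^-1).
  apply: ParabolicM; last exact: ParabolicV.
  by apply: ParabolicM => //; apply: ParabolicGen.
by rewrite !mulgA E mulgK leqNgt ltv.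
Qed.

Lemma parabolic_decomp_exists J w : exists v u, parabolic_decomp J w v u.
Proof.
have [n] := ubnP (len w); elim: n w => // n IH w; rewrite ltnS => lew.
case: (pselect (min_coset_rep J w)) => [wJ|].
  by exists w, 1; split=> //; [apply: Parabolic1|rewrite mulg1].
rewrite /min_coset_rep -existsNE => -[x]; rewrite not_implyE => -[xJ].
move/negP; rewrite -ltnNge => lt.
have [|v [u [vJ uJ E]]] := IH (w * x); first exact: leq_trans lt lew.
exists v, (u * x^-1); split=> //.
  by apply: ParabolicM => //; apply: ParabolicV.
by rewrite mulgA -E mulgK.
Qed.

Lemma min_coset_repP J v :
  min_coset_rep J v <-> forall s, s \in J -> len v <= len (v * gen s).
Proof.
split=> [vJ s sJ|vJ]; first by apply/vJ/ParabolicGen.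
have [v0 [x [v0J xJ vE]]] := parabolic_decomp_exists J v.
suff x1 : x = 1 by rewrite vE x1 mulg1.
have vs s : s \in J -> len x <= len (x * gen s).
  move=> sJ; have := vJ s sJ; have gJ := ParabolicGen (W := W) sJ.
  rewrite vE -mulgA (min_coset_repM v0J xJ) (min_coset_repM v0J) ?leq_add2l //.
  exact: ParabolicM.
elim/parabolic_len_ind: xJ vs {vE} => // y s yJ sJ ls _ /(_ s sJ).
by rewrite mulgenK ls ltnn.
Qed.

(** * Bruhat order and supports *)

Lemma bruhat_le_parabolic I u v :
  bruhat_le u v -> parabolic I v -> parabolic I u.
Proof.
elim=> {u v} [u v [t rt [-> lt]] uI|//|u v w _ IHu _ IHv /IHv] //.
have := parabolic_strong_exchange rt uI.
by rewrite -mulgA (reflectionK rt) mulg1; apply.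
Qed.

Lemma Supp_parabolic I w : parabolic I w -> Supp w \subset I.
Proof.
move=> wI; apply/subsetP => s; rewrite inE => /asboolP /bruhat_le_parabolic sw.
exact: parabolic_gen (sw I wI).
Qed.

Lemma bruhat_le_mulgen w s : len (w * gen s) = (len w).+1 ->
  bruhat_le w (w * gen s).
Proof.
by move=> E; apply: rt_step; exists (gen s); [apply: reflection_gen|rewrite E].
Qed.

Lemma bruhat_le_genmul w s : len (gen s * w) = (len w).+1 ->
  bruhat_le w (gen s * w).
Proof.
move=> E; apply: rt_step; exists (gen s ^ w); first by exists s, w.
by rewrite -conjgC E.
Qed.

(** Letters are removed from the two ends of the reduced word until only [s] is left; each removal
    goes down in Bruhat order. *)
Lemma bruhat_le_letter a s : size a = len (word_prod gen a : W) -> s \in a ->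
  bruhat_le (gen s) (word_prod gen a : W).
Proof.
have [n] := ubnP (size a); elim: n a s => // n IH [|t a] s //.
rewrite ltnS => lea sz.
have sa : size a = len (word_prod gen a : W).
  apply/eqP; rewrite eqn_leq len_le andbT -ltnS -[_.+1]/(size (t :: a)) sz.
  by rewrite word_prod_cons (leq_trans (lenM _ _)) // len_gen add1n.
rewrite inE => /orP[/eqP->|sina]; last first.
  apply: (@rt_trans _ _ _ (word_prod gen a)); first exact: IH.
  by rewrite word_prod_cons; apply: bruhat_le_genmul;
     rewrite -word_prod_cons -sz -sa.
elim/last_ind: a {sa} lea sz => [|a r _] lea sz.
  by rewrite word_prod_cons word_prod_nil mulg1; apply: rt_refl.
have sta : size (t :: a) = len (word_prod gen (t :: a) : W).
  apply/eqP; rewrite eqn_leq len_le andbT -ltnS -(size_rcons (t :: a) r).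
  rewrite rcons_cons sz -rcons_cons word_prod_rcons.
  by rewrite (leq_trans (lenM _ _)) // len_gen addn1.
apply: (@rt_trans _ _ _ (word_prod gen (t :: a))).
  by apply: IH => //=; rewrite ?mem_head // -ltnS -(size_rcons a r).
rewrite -rcons_cons word_prod_rcons; apply: bruhat_le_mulgen.
by rewrite -word_prod_rcons -sta -sz /= size_rcons.
Qed.

(** Together with [Supp_parabolic], this makes [Supp w] the least [I] with [w] in [W_I]. *)
Lemma parabolic_Supp w : parabolic (Supp w) w.
Proof.
have [a aw sa] := len_word w; rewrite -{2}aw; apply: parabolic_word => s sina.
by rewrite inE; apply/asboolP; rewrite -aw; apply: bruhat_le_letter; rewrite ?aw.
Qed.

Lemma SuppM x y : Supp (x * y) \subset Supp x :|: Supp y.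
Proof.
apply: Supp_parabolic; apply: ParabolicM.
  exact: parabolicS (subsetUl _ _) (parabolic_Supp x).
exact: parabolicS (subsetUr _ _) (parabolic_Supp y).
Qed.

Lemma parabolic_reducedM I x y : len (x * y) = len x + len y ->
  parabolic I (x * y) -> parabolic I x /\ parabolic I y.
Proof.
have [a <- <-] := len_word x; have [b <- <-] := len_word y.
rewrite -word_prod_cat -size_cat => sz /parabolic_reduced_word abI.
by split; apply: parabolic_word => s sab; apply: abI; rewrite ?mem_cat ?sab ?orbT.
Qed.

Lemma parabolic_has_descent I x : parabolic I x -> x <> 1 ->
  exists2 s, s \in I & len (x * gen s) < len x.
Proof.
elim/parabolic_len_ind => {x} // x s _ sI ls _ _; exists s => //.
by rewrite mulgenK ls.
Qed.

Lemma parabolic1 s x : parabolic [set s] x -> x = 1 \/ x = gen s.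
Proof.
elim/parabolic_len_ind => {x} [|x t _ /set1P-> _ [->|->]]; first by left.
  by right; rewrite mul1g.
by left; rewrite genK.
Qed.

Lemma min_coset_rep_descent J v x s : min_coset_rep J v -> parabolic J x ->
  len (x * gen s) < len x -> len (v * x * gen s) < len (v * x).
Proof.
move=> vJ xJ lt; rewrite (min_coset_repM vJ xJ) -mulgA.
by rewrite (leq_ltn_trans (lenM _ _)) // ltn_add2l.
Qed.

Lemma len_mul_left_longest I u x : I \subset DL u -> parabolic I x ->
  len (x * u) + len x = len u.
Proof.
move=> /subsetP uI xI; rewrite -(lenV u) -(lenV (x * u)) invgM.
apply: (len_mul_longest (I := I)) => // s /uI.
by rewrite inE -lenV invgM genV -[len u]lenV.
Qed.

Lemma DL_parabolic I u : parabolic I u -> DL u \subset I.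
Proof.
move=> uI; apply/subsetP => s; rewrite inE -lenV invgM genV -[len u]lenV.
exact: parabolic_descent (ParabolicV uI).
Qed.

(** * Criteria for membership in [BP w] *)

Lemma BP0 w : BP w set0.
Proof.
exists w, 1; split; last by rewrite setI0 sub0set.
split; [|exact: Parabolic1|by rewrite mulg1].
by apply/min_coset_repP => s; rewrite inE.
Qed.

Lemma BPT w : BP w setT.
Proof.
exists 1, w; split; last first.
  have /subsetP s0 : Supp (1 : W) \subset set0 by apply/Supp_parabolic/Parabolic1.
  by apply/subsetP => s /setIP[/s0]; rewrite inE.
split; [|exact: parabolicS (subsetT _) (parabolic_Supp w)|by rewrite mul1g].
by move=> x _; rewrite len1.
Qed.

Lemma BP_right_descents w I : (forall s, s \in I -> len (w * gen s) < len w) ->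
  BP w I.
Proof.
move=> wI; have [v [u [vI uI wE]]] := parabolic_decomp_exists I w.
exists v, u; split=> //; apply/subsetP => s /setIP[_ sI]; rewrite inE.
rewrite ltnNge; apply/negP => le.
have ls : len (gen s * u) = (len u).+1.
  rewrite -lenV invgM genV -[len u]lenV; apply: len_gen_geE.
  by rewrite -[gen s]genV -invgM !lenV.
(* If [s] lengthened [u] on the left, splitting [gen s * u] off [w] would leave [v * gen s], shorter
   than the minimal [v]. *)
have suI : parabolic I (gen s * u).
  by apply: ParabolicM => //; apply: ParabolicGen.
have := len_mul_longest wI suI.
rewrite {1}wE invgM genV mulgA mulgK wE (min_coset_repM vI uI) ls addnS.
move=> lvs; have := vI _ (ParabolicGen sI); rewrite -(leq_add2r (len u)) -lvs.
by rewrite ltnn.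
Qed.

(** The same pair [v], [u] serves: [s] is neither in [Supp v] nor a right descent of [v]. *)
Lemma BP_setU1_Supp w K s : s \notin Supp w -> BP w K -> BP w (s |: K).
Proof.
move=> sw [v [u [[vK uK wE] sub]]].
have [] := @parabolic_reducedM (Supp w) v u; rewrite -?wE ?parabolic_Supp //.
  by rewrite wE (min_coset_repM vK uK).
  exact: parabolic_Supp.
move=> vw uw; have vs t : len (v * gen t) < len v -> t \in Supp w.
  exact: parabolic_descent.
exists v, u; split; first split=> //; last 2 first.
- exact: parabolicS (subsetUr _ _) uK.
- apply/subsetP => t /setIP[tv /setU1P[ts|tK]].
    by move: sw; rewrite -ts (subsetP (Supp_parabolic vw)).
  by apply: (subsetP sub); rewrite inE tv.
apply/min_coset_repP => t /setU1P[->|tK]; last by apply/vK/ParabolicGen.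
by rewrite leqNgt; apply: contra sw => /vs.
Qed.

Lemma BP1 w s : BP w [set s] -> len (w * gen s) < len w \/ s \notin Supp w.
Proof.
move=> [v [u [[vJ uJ wE] sub]]]; case: (parabolic1 uJ) => uE.
  right; apply/negP => sw.
  have : s \in DL u.
    by apply: (subsetP sub); rewrite inE set11 -(mulg1 v) -uE -wE sw.
  by rewrite inE uE mulg1 len1.
left; rewrite wE uE; apply: (min_coset_rep_descent vJ); first by rewrite -uE.
by rewrite genK len1 len_gen.
Qed.

(** * Union of two singletons and intersection of two pairs *)

Lemma BP_setU1 w s t : BP w [set s] -> BP w [set t] -> BP w [set s; t].
Proof.
move=> sw tw; case: (BP1 sw) => [ws|]; last by move/BP_setU1_Supp; apply.
case: (BP1 tw) => [wt|]; last by rewrite setUC => /BP_setU1_Supp; apply.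
by apply: BP_right_descents => r /set2P[]->.
Qed.

Lemma BP_last_letters w s t : s != t -> BP w [set s; t] -> t \in Supp w ->
  len w <= len (w * gen t) ->
  exists v u, [/\ parabolic_decomp [set s; t] w v u,
    Supp v :&: [set s; t] \subset DL u, len u <= len (u * gen t),
    len (w * gen s) < len w & len (w * gen s * gen t) < len (w * gen s)].
Proof.
move=> st [v [u [[vJ uJ wE] sub]]] tw wt; exists v, u.
have ut : len u <= len (u * gen t).
  rewrite leqNgt; apply: contraL wt => /(min_coset_rep_descent vJ uJ).
  by rewrite -wE -ltnNge.
(* Otherwise [t] is in [Supp v], so the BP condition makes it a left descent of [u], impossible in
   [W_{s}]. Hence [u] is neither 1 nor [gen s], and its last two letters are forced to be [t],
   [s]. *)
have us1 : ~ parabolic [set s] u.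
  move=> us; have /negP[] : t \notin DL u.
    apply: contra st => /(subsetP (DL_parabolic us)).
    by rewrite inE eq_sym.
  apply: (subsetP sub); rewrite inE set22 andbT; move: tw.
  rewrite wE => /(subsetP (SuppM v u)) /setUP[//|].
  by move/(subsetP (Supp_parabolic us)); rewrite inE eq_sym (negbTE st).
have u1 : u <> 1 by move=> u1; apply: us1; rewrite u1; apply: Parabolic1.
have uls : len (u * gen s) < len u.
  have [r /set2P[->|->]] // := parabolic_has_descent uJ u1.
  by rewrite ltnNge ut.
have usJ : parabolic [set s; t] (u * gen s).
  by apply: ParabolicM => //; apply/ParabolicGen/set21.
have [|r /set2P[->|->]] := parabolic_has_descent usJ.
- move=> us; apply: us1; rewrite -(mulgenK s u) us mul1g.
  exact/ParabolicGen/set11.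
- by rewrite mulgenK ltnNge ltnW.
move=> ult; split=> //.
  by rewrite wE; apply: min_coset_rep_descent vJ uJ uls.
by rewrite wE -(mulgA v); apply: min_coset_rep_descent vJ usJ ult.
Qed.

Lemma BP_setI1 w s t (r : S) : s != t -> r != t -> s != r ->
  BP w [set s; t] -> BP w [set r; t] -> BP w [set t].
Proof.
move=> st rt sr wJ wK.
have [tw|/BP_setU1_Supp] := boolP (t \in Supp w); last first.
  by move=> /(_ set0); rewrite setU0; apply; apply: BP0.
case: (ltnP (len (w * gen t)) (len w)) => [lt|wt].
  by apply: BP_right_descents => _ /set1P->.
have [v [u [[vJ uJ wE] sub ut ws _]]] := BP_last_letters st wJ tw wt.
have [_ [_ [_ _ _ wr wrt]]] := BP_last_letters rt wK tw wt.
(* Both [s] and [r] are right descents of [w], so the length-two element [gen s * gen r] splits off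
   on the right. *)
have wrs : len (w * gen r * gen s) < len (w * gen r).
  have w0 q : q \in [set s; r] -> len (w * gen q) < len w by case/set2P=> ->.
  have srP : parabolic [set s; r] (gen s * gen r).
    by apply: ParabolicM; apply: ParabolicGen; rewrite (set21, set22).
  have := len_mul_longest w0 srP; rewrite invgM !genV mulgA.
  have lsr : len (gen s * gen r : W) = 2.
    have : len (gen s : W) <= len (gen s * gen r : W).
      rewrite len_gen lt0n; apply: contra sr => /eqP/len_eq0/mulg1_eq.
      by rewrite genV => /gen_inj ->.
    by move/len_gen_geE; rewrite len_gen.
  by rewrite lsr (len_gen_ltP _ _ wr) addn2 => -[->].
have [||] := @exchange v u r; first by rewrite -wE.
- move/(parabolic_descent uJ) => /set2P[] e; first by rewrite e eqxx in sr.
  by rewrite e eqxx in rt.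
case=> v' [_ wrE /(_ _ (parabolic_Supp v)) v'I]; rewrite -wE in wrE.
set I := Supp v in v'I.
(* Decomposing along [I :&: [set s; t]] instead of [[set s; t]] keeps [x] in the subgroup generated
   by known left descents of [u]. Minimality of [v1] for [[set s; t]] is not lost, since its right
   descents lie in [I]. *)
have [v1 [x [v1IJ xIJ v'E]]] := parabolic_decomp_exists (I :&: [set s; t]) v'.
have v1I : parabolic I v1.
  apply: (parabolic_mull (y := x)); last by rewrite -v'E.
  exact: parabolicS (subsetIl _ _) xIJ.
have v1J : min_coset_rep [set s; t] v1.
  apply/min_coset_repP => q qJ; rewrite leqNgt; apply/negP => lt.
  have qI := parabolic_descent v1I lt.
  have qIJ : q \in I :&: [set s; t] by rewrite in_setI qI.
  by have := v1IJ _ (ParabolicGen qIJ); rewrite leqNgt lt.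
have xJ := parabolicS (subsetIr _ _) xIJ.
have wr0 q : q \in [set s; t] -> len (w * gen r * gen q) < len (w * gen r).
  by case/set2P=> ->.
have utJ : parabolic [set s; t] (u * gen t).
  by apply: ParabolicM => //; apply/ParabolicGen/set22.
(* After cancelling [len v1] this yields [len (u * gen t) <= len (x * u)]. *)
have := len_mul_longest wr0 utJ.
have xuJ := ParabolicM xJ uJ.
rewrite wrE v'E -!mulgA (min_coset_repM v1J xuJ) (min_coset_repM v1J); last first.
  by rewrite mulgA; apply: ParabolicM xuJ (ParabolicV utJ).
rewrite -addnA => /addnI lxu.
(* This yields [len (x * u) <= len u], contradicting that [t] lengthens [u]. *)
have := len_mul_left_longest sub xIJ.
rewrite -lxu (len_gen_geE ut) => lu; have := ltnn (len u).
by rewrite -{2}lu addnAC addnS ltnS leq_addl.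
Qed.

End CoxeterTheory.

(** * Case analysis in rank three *)

Theorem theorem3p15 (W : coxeterSystem) (rank3 : #|simple_refl W| = 3)
    (w : W) (J K : {set simple_refl W}) (hJ : BP w J) (hK : BP w K) :
  BP w (J :&: K) /\ BP w (J :|: K).
Proof.
move: hJ hK => wJ wK.
have [JK|/subsetPn[s sJ sK]] := boolP (J \subset K).
  by rewrite (setIidPl JK) (setUidPr JK).
have [KJ|/subsetPn[r rK rJ]] := boolP (K \subset J).
  by rewrite (setIidPr KJ) (setUidPl KJ).
have sr : s != r by apply: contraNneq sK => ->.
have /subsetPn[t _ tsr] : ~~ ([set: simple_refl W] \subset [set s; r]).
  by apply/negP => /subset_leq_card; rewrite cardsT rank3 cards2 sr.
have S3 q : q \in t |: [set s; r].
  suff -> : t |: [set s; r] = setT by rewrite inE.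
  by apply/eqP; rewrite eqEcard subsetT cardsT rank3 cardsU1 tsr cards2 sr.
have split3 (I I' : {set simple_refl W}) :
    (s \in I) = (s \in I') -> (r \in I) = (r \in I') ->
    (t \in I) = (t \in I') -> I = I'.
  by move=> Is Ir It; apply/setP => q; case/setU1P: (S3 q) => [->|/set2P[]->].
have [ts tr] : t != s /\ t != r.
  by move: tsr; rewrite !inE negb_or => /andP[].
move/negbTE: sK => sK; move/negbTE: rJ => rJ.
have eqs := (eqxx, negbTE sr, negbTE ts, negbTE tr,
             eq_sym s t, eq_sym r t, eq_sym r s).
(* With [s] only in [J] and [r] only in [K], the third letter [t] decides everything. If it lies in
   exactly one of the two sets, they are complementary. *)
have [tJ|/negbTE tJ] := boolP (t \in J); have [tK|/negbTE tK] := boolP (t \in K).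
- have JE : J = [set s; t] by apply: split3; rewrite !inE ?eqs ?sJ ?tJ ?rJ.
  have KE : K = [set r; t] by apply: split3; rewrite !inE ?eqs ?rK ?tK ?sK.
  split.
    have -> : J :&: K = [set t].
      by apply: split3; rewrite JE KE !inE ?eqs.
    by apply: (@BP_setI1 W w s t r); rewrite -?JE -?KE // eq_sym.
  have -> : J :|: K = setT by apply: split3; rewrite JE KE !inE ?eqs.
  exact: BPT.
- have -> : J :&: K = set0.
    by apply: split3; rewrite !inE ?sK ?rJ ?tK ?andbF.
  have -> : J :|: K = setT by apply: split3; rewrite !inE ?sJ ?rK ?tJ ?orbT.
  by split; [apply: BP0|apply: BPT].
- have -> : J :&: K = set0.
    by apply: split3; rewrite !inE ?sK ?rJ ?tJ ?andbF.
  have -> : J :|: K = setT by apply: split3; rewrite !inE ?sJ ?rK ?tK ?orbT.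
  by split; [apply: BP0|apply: BPT].
have JE : J = [set s] by apply: split3; rewrite !inE ?eqs ?sJ ?tJ ?rJ.
have KE : K = [set r] by apply: split3; rewrite !inE ?eqs ?rK ?tK ?sK.
split; last by rewrite JE KE; apply: BP_setU1; rewrite -?JE -?KE.
have -> : J :&: K = set0 by apply: split3; rewrite JE KE !inE ?eqs.
exact: BP0.
Qed.
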